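(* Let $\mathcal C$ be a finite groupoid and $\rho,\sigma\in\mathrm{wr}(\mathcal C)$. Then $\rho$ and $\sigma$ are conjugate in $\mathrm{wr}(\mathcal C)$ if and only if $c(\rho)=c(\sigma)$. If these equivalent conditions hold, the number of $\alpha\in\mathrm{wr}(\mathcal C)$ with $\alpha\rho=\sigma\alpha$ equals $$\prod_{k\ge1,\ [\gamma]\in\digamma(\mathcal C)}\Big(c(\rho,k,[\gamma])!\cdot\big(k\cdot\#C_{\mathcal C}(\gamma)\big)^{c(\rho,k,[\gamma])}\Big).$$ Moreover, if $\mathcal D$ is a wide subgroupoid of $\mathcal C$, the number of $\alpha\in\mathrm{wr}(\mathcal D)$ with $\alpha\rho=\sigma\alpha$ is at most $(\#\mathrm{aut}(\mathcal D))^{N}$, where $N$ is the number of orbits of $\langle r\rangle$ on $\mathrm{obj}(\mathcal C)$ (with $\rho=((\rho_K)_K,r)$).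
   Context: The wreath $\mathrm{wr}(\mathcal C)$ of a finite groupoid $\mathcal C$ is the group of pairs $\sigma=((\sigma_K)_{K\in\mathrm{obj}(\mathcal C)},s)$ with $s$ a permutation of $\mathrm{obj}(\mathcal C)$ and $\sigma_K\in\mathrm{Hom}_{\mathcal C}(K,s(K))$, with composition $((\sigma_K)_K,s)\circ((\rho_K)_K,r)=((\sigma_{r(K)}\circ\rho_K)_K,s\circ r)$. $\mathrm{wr}(\mathcal D)\subseteq\mathrm{wr}(\mathcal C)$ for a wide subgroupoid $\mathcal D$ (same objects). $\mathrm{aut}(\mathcal D)$ is the set of all automorphisms of all objects of $\mathcal D$. For $K\in\mathrm{obj}$ with $\langle s\rangle$-orbit of length $n$, $\lambda_\sigma(K)=\sigma_{s^{n-1}(K)}\circ\cdots\circ\sigma_{s(K)}\circ\sigma_K\in\mathrm{Aut}_{\mathcal C}(K)$. Two automorphisms $\alpha\in\mathrm{Aut}(K)$, $\beta\in\mathrm{Aut}(L)$ are $\mathcal C$-conjugate if $\omega\alpha=\beta\omega$ for some $\omega\in\mathrm{Hom}_{\mathcal C}(K,L)$; $\digamma(\mathcal C)$ is the set of classes of this equivalence relation on $\mathrm{aut}(\mathcal C)$. The label of an orbit $O$ of $\langle s\rangle$ is the class of $\lambda_\sigma(K)$ for any $K\in O$ (independent of $K$). $c(\sigma,k,[\gamma])$ is the number of $\langle s\rangle$-orbits of length $k$ with label $[\gamma]$, and $c(\sigma)=(c(\sigma,k,[\gamma]))_{k,[\gamma]}$. For $\gamma\in\mathrm{Aut}_{\mathcal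 C}(K)$, $C_{\mathcal C}(\gamma)$ is its centralizer in $\mathrm{Aut}_{\mathcal C}(K)$ (its size depends only on $[\gamma]$). *)

(* Defs.v *)
From mathcomp Require Import all_boot all_fingroup.
Set Implicit Arguments. Unset Strict Implicit. Unset Printing Implicit Defensive.

(* A finite groupoid, in single-sorted form: a finite type of objects, a
   finite type of morphisms with source/target maps, identities, a total
   composition function (meaningful only on composable pairs;
   gcomp g f = g o f when src g = tgt f) and inverses. *)
Record groupoid := Groupoid {
  gobj : finType;
  gmor : finType;
  src : gmor -> gobj;
  tgt : gmor -> gobj;
  gid : gobj -> gmor;
  gcomp : gmor -> gmor -> gmor;
  ginv : gmor -> gmor;
  src_id : forall K, src (gid K) = K;
  tgt_id : forall K, tgt (gid K) = K;
  src_comp : forall g f, src g = tgt f -> src (gcomp g f) = src f;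
  tgt_comp : forall g f, src g = tgt f -> tgt (gcomp g f) = tgt g;
  compA : forall h g f, src h = tgt g -> src g = tgt f ->
            gcomp h (gcomp g f) = gcomp (gcomp h g) f;
  comp_id_r : forall f, gcomp f (gid (src f)) = f;
  comp_id_l : forall f, gcomp (gid (tgt f)) f = f;
  src_inv : forall f, src (ginv f) = tgt f;
  tgt_inv : forall f, tgt (ginv f) = src f;
  inv_l : forall f, gcomp (ginv f) f = gid (src f);
  inv_r : forall f, gcomp f (ginv f) = gid (tgt f)
}.

Section Wreath.
Variable C : groupoid.
Local Notation O := (gobj C).
Local Notation M := (gmor C).

Definition wrT := ({ffun O -> M} * {perm O})%type.

Definition wr : {set wrT} :=
  [set x : wrT | [forall K, (src (x.1 K) == K) && (tgt (x.1 K) == x.2 K)]].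

(* ((sigma_K),s) o ((rho_K),r) = ((sigma_{r K} o rho_K), s o r);
   in mathcomp (r * s) x = s (r x). *)
Definition wmul (sg rh : wrT) : wrT :=
  ([ffun K => gcomp (sg.1 (rh.2 K)) (rh.1 K)], (rh.2 * sg.2)%g).

Definition wr_conj (rh sg : wrT) : Prop :=
  exists2 a, a \in wr & wmul a rh = wmul sg a.

Fixpoint lam_iter (sg : wrT) (K : O) (m : nat) : M :=
  match m with
  | 0 => gid K
  | m'.+1 => gcomp (sg.1 (iter m' sg.2 K)) (lam_iter sg K m')
  end.

Definition lam (sg : wrT) (K : O) : M := lam_iter sg K #|porbit sg.2 K|.

Definition autC : {set M} := [set f | src f == tgt f].

Definition gconj (a b : M) : bool :=
  [exists w, [&& src w == src a, tgt w == src b & gcomp w a == gcomp b w]].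

Definition cls (g : M) : {set M} := [set b in autC | gconj g b].

Definition digamma : {set {set M}} := [set cls g | g in autC].

Definition centr (g : M) : {set M} :=
  [set b | [&& src b == src g, tgt b == src g & gcomp b g == gcomp g b]].

Definition csize (X : {set M}) : nat :=
  if [pick g in X] is Some g then #|centr g| else 0.

Definition cnt (sg : wrT) (k : nat) (X : {set M}) : nat :=
  #|[set Ob in porbits sg.2 |
      (#|Ob| == k) && [exists K in Ob, cls (lam sg K) == X]]|.

Definition wide_subgroupoid (D : {set M}) : Prop :=
  [/\ forall K, gid K \in D,
      forall g f, g \in D -> f \in D -> src g = tgt f -> gcomp g f \in D &
      forall f, f \in D -> ginv f \in D].

Definition wrD (D : {set M}) : {set wrT} :=
  [set x in wr | [forall K, x.1 K \in D]].

Definition autD (D : {set M}) : {set M} := [set f in D | src f == tgt f].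

Definition ncommute (A : {set wrT}) (rh sg : wrT) : nat :=
  #|[set a in A | wmul a rh == wmul sg a]|.

End Wreath.

(* Main.v *)
Require Import Defs.
From mathcomp Require Import all_boot all_fingroup.
Set Implicit Arguments. Unset Strict Implicit. Unset Printing Implicit Defensive.

(** An element [a] with [a rh = sg a] is determined by its components at one
    chosen representative [K_i] of each orbit [i] of [rh.2], since
    [a_(r K) = sg_(a K) a_K rh_K^-1].  A family [w_i] with source [K_i] comes
    from such an [a] iff each [w_i] intertwines [lam rh K_i] with
    [lam sg (tgt w_i)], the orbits of [K_i] and [tgt w_i] have equal length,
    and [i |-> orbit of tgt w_i] is injective.  So one chooses a bijection
    between orbits preserving length and label ([c!] ways for each type), and
    then, for each orbit, a target in the matched orbit ([k] ways) and an
    intertwiner (a torsor under the centralizer).  Equal cycle counts make this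
    product positive, hence [rh] and [sg] conjugate.  For a wide subgroupoid
    [D], the same data are [D]-morphisms out of the [K_i]. *)

(** * Counting label-preserving maps between finite sets *)

Section FibrePreservingMaps.
Variables (I J T : finType) (t : I -> T) (u : J -> T).

(* Splitting off [x] from [s], such a permutation is uniquely the product of a
   permutation of the fibre over [x] and one for the remaining values. *)
Lemma card_fibre_perm_in (s : seq T) : uniq s ->
  #|[set p : {perm I} |
      [forall i, (t (p i) == t i) && ((t i \notin s) ==> (p i == i))]]| =
  \prod_(x <- s) #|[set i | t i == x]|`!.
Proof.
elim: s => [_ | x s IHs /= /andP[xNs /IHs {}IHs]].
  rewrite big_nil; apply/eqP/cards1P; exists 1%g; apply/setP=> p.
  rewrite !inE; apply/forallP/eqP => [H | -> i]; last by rewrite perm1 !eqxx.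
  by apply/permP=> i; have /andP[_ /eqP->] := H i; rewrite perm1.
rewrite big_cons -IHs; set A := [set i | t i == x].
rewrite -(card_perm A) -[#|perm_on A|]cardsE -cardsX.
pose S (s' : seq T) : {set {perm I}} :=
  [set p : {perm I} | [forall i, (t (p i) == t i) && ((t i \notin s') ==> (p i == i))]].
rewrite -/(S s) -/(S (x :: s)); set B := S s; set P := S (x :: s).
have BoutA (p : {perm I}) i : p \in B -> i \in A -> p i = i.
  rewrite !inE => /forallP/(_ i)/andP[_ H] /eqP ti.
  by apply/eqP; move: H; rewrite ti xNs.
rewrite -(_ : [set (z.1 * z.2)%g | z in setX [set p : {perm I} | perm_on A p] B] = P).
  rewrite card_in_imset // => -[p q] [p' q'] /=.
  rewrite !in_setX /= ![_ \in [set p0 | perm_on A p0]]inE => /andP[pA qB] /andP[p'A q'B] e.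
  suff epp : p = p' by move: e; rewrite epp => /mulgI->.
  apply/permP=> i; have [iA | iNA] := boolP (i \in A); last first.
    by rewrite (out_perm pA iNA) (out_perm p'A iNA).
  have := congr1 (fun z : {perm I} => z i) e.
  by rewrite !permM !(BoutA _ _ qB, BoutA _ _ q'B) ?perm_closed.
apply/setP=> p; apply/imsetP/idP => [[[a b]] | ].
  rewrite in_setX /= inE => /andP[aA bB] ->; rewrite inE; apply/forallP=> i.
  rewrite permM inE negb_or; have [iA | iNA] := boolP (i \in A).
    rewrite (BoutA _ _ bB) ?perm_closed //.
    have: a i \in A by rewrite perm_closed.
    by move: iA; rewrite !inE => /eqP-> /eqP->; rewrite !eqxx.
  rewrite (out_perm aA iNA); move: bB; rewrite inE => /forallP/(_ i)/andP[-> /=].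
  by move=> /implyP H; apply/implyP=> /andP[_ /H].
rewrite inE => /forallP pP.
have tp i : t (p i) = t i by have /andP[/eqP] := pP i.
have pN : p \in 'N(A | 'P)%g.
  apply/astabsP=> i; rewrite !inE /= /aperm tp //.
(* The factor on the fibre is [p] restricted to [A], which [p] stabilises; the quotient [a^-1 * p]
   then fixes [A] pointwise. *)
have aA := restr_perm_on A p; set a := restr_perm A p in aA.
exists (a, (a^-1 * p)%g) => /=; last by rewrite mulKVg.
rewrite in_setX /= inE aA inE; apply/forallP=> i; rewrite permM.
have [iA | iNA] := boolP (i \in A).
  have aVA : (a^-1)%g i \in A by rewrite perm_closed ?perm_onV.
  by rewrite -(restr_permE pN aVA) -/a permKV !eqxx implybT.
rewrite (out_perm (perm_onV aA) iNA); have /andP[-> /implyP H] := pP i.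
by apply/implyP=> tis; apply: H; rewrite inE negb_or tis andbT; rewrite inE in iNA.
Qed.

Lemma card_fibre_perm :
  #|[set p : {perm I} | [forall i, t (p i) == t i]]| =
  \prod_x #|[set i | t i == x]|`!.
Proof.
rewrite -big_enum -card_fibre_perm_in ?enum_uniq //.
apply: eq_card => p; rewrite !inE; apply: eq_forallb => i.
by rewrite mem_enum andbT.
Qed.

Hypothesis eq_fibres : forall x, #|[set i | t i == x]| = #|[set j | u j == x]|.

(** Elements of corresponding fibres are matched by their positions in the two enumerations, which
    have equal length. *)
Lemma fibre_bij_exists :
  exists2 phi : I -> J, bijective phi & forall i, u (phi i) = t i.
Proof.
pose A i := enum [set i' | t i' == t i]; pose B i := enum [set j | u j == t i].
have iA i : i \in A i by rewrite mem_enum inE.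
have [i | phi phiP] := @fin_all_exists _ _
    (fun i j => u j = t i /\ index j (B i) = index i (A i)).
  have lt : index i (A i) < size (B i).
    by rewrite -cardE -eq_fibres cardE index_mem iA.
  (* The bound [lt] makes [B i] non-empty; its head [j0] only serves as the default of [nth]. *)
  case E: (B i) (lt) => [//|j0 s] _; exists (nth j0 (B i) (index i (A i))).
  have := mem_nth j0 lt; rewrite mem_enum inE => /eqP->; split=> //.
  by rewrite -E index_uniq ?enum_uniq.
have cIJ : #|J| = #|I|.
  rewrite -[LHS]sum1_card -[RHS]sum1_card (partition_big u xpredT) //=.
  rewrite [RHS](partition_big t xpredT) //=; apply: eq_bigr => x _.
  by rewrite !sum1_card -[LHS]cardsE -[RHS]cardsE; apply/esym/eq_fibres.
exists phi; last by move=> i; have [] := phiP i.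
apply: inj_card_bij; last by rewrite cIJ.
move=> i i' e; have [ui xi] := phiP i; have [ui' xi'] := phiP i'.
have ti : t i = t i' by rewrite -ui -ui' e.
have eA : A i = A i' by rewrite /A ti.
apply: (@index_inj _ i (A i)); rewrite ?iA //; first by rewrite eA iA.
by rewrite -xi [in RHS]eA -xi' /B ti e.
Qed.

(** Composition with a fixed label-preserving bijection [phi] turns the permutations of [I] that
    preserve [t] into these injections. *)
Lemma card_fibre_injection :
  #|[set f : {ffun I -> J} | injectiveb f && [forall i, u (f i) == t i]]| =
  \prod_x #|[set i | t i == x]|`!.
Proof.
have [phi [psi phiK psiK] uphi] := fibre_bij_exists.
rewrite -card_fibre_perm.
rewrite -(card_imset _ (_ : injective (fun p : {perm I} => [ffun i => phi (p i)]))); last first.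
  by move=> p p' /ffunP e; apply/permP=> i; have:= e i; rewrite !ffunE => /(can_inj phiK).
apply: eq_card => f; rewrite inE; apply/andP/imsetP => [[/injectiveP fI /forallP uf] | [p]].
  have gI : injective (psi \o f) by apply: inj_comp fI; apply: can_inj psiK.
  exists (perm gI); last by apply/ffunP=> i; rewrite ffunE permE /= psiK.
  by rewrite inE; apply/forallP=> i; rewrite permE /= -uphi psiK.
rewrite inE => /forallP tp ->; split.
  by apply/injectiveP=> i j; rewrite !ffunE => /(can_inj phiK)/perm_inj.
by apply/forallP=> i; rewrite ffunE uphi.
Qed.

Variables (M : finType) (q : M -> J) (W : I -> {set M}) (n : T -> nat).
Hypothesis q_fibre : forall i w, w \in W i -> u (q w) = t i.
Hypothesis card_W : forall i j, u j = t i -> #|[set w in W i | q w == j]| = n (t i).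

(** Group the [f] by the injection [tau] they induce through [q]. Over each [tau] the lifts are
    chosen independently at each [i], in [n (t i)] ways. Below, [q] sends a morphism to the orbit of
    its target. *)
Lemma card_fibre_injection_lift :
  #|[set f : {ffun I -> M} |
      [forall i, f i \in W i] && injectiveb [ffun i => q (f i)]]| =
  \prod_x (#|[set i | t i == x]|`! * n x ^ #|[set i | t i == x]|).
Proof.
pose Q (tau : {ffun I -> J}) := injectiveb tau && [forall i, u (tau i) == t i].
rewrite -sum1_card (partition_big (fun f : {ffun I -> M} => [ffun i => q (f i)]) Q); last first.
  move=> f; rewrite inE => /andP[/forallP fW inj_qf]; rewrite /Q inj_qf /=.
  by apply/forallP=> i; rewrite ffunE (q_fibre (fW i)).
have tn : \prod_i n (t i) = \prod_x n x ^ #|[set i | t i == x]|.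
  rewrite (partition_big t xpredT) //=; apply: eq_bigr => x _.
  rewrite -prod_nat_const; apply: congr_big => // i; first by rewrite !inE.
  by move/eqP->.
rewrite big_split /= -tn -card_fibre_injection -sum_nat_const.
apply: congr_big => // [tau | tau /andP[tauI /forallP utau]]; first by rewrite inE.
rewrite sum1_card.
transitivity #|(family (fun i => [set w in W i | q w == tau i]) : pred {ffun I -> M})|.
  apply: eq_card => f; rewrite unfold_in /= inE -andbA.
  apply/and3P/familyP => [[/forallP fW _ /eqP/ffunP e] i | H].
    by rewrite inE fW -e ffunE /=.
  have qf : [ffun i => q (f i)] = tau.
    by apply/ffunP=> i; rewrite ffunE; have:= H i; rewrite inE => /andP[_ /eqP].
  rewrite qf; split=> //; apply/forallP=> i.
  by have:= H i; rewrite inE => /andP[].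
rewrite card_family foldrE big_map big_enum.
by apply: eq_bigr => i _; apply/card_W/eqP.
Qed.

End FibrePreservingMaps.

(** * Intertwiners, conjugacy and centralizers in a groupoid *)

Section Groupoid.
Variable C : groupoid.
Local Notation O := (gobj C).
Local Notation M := (gmor C).
Implicit Types (f g h a b c w : M) (K L : O).

Lemma gcompK g f : src g = tgt f -> gcomp (ginv g) (gcomp g f) = f.
Proof. by move=> e; rewrite Defs.compA ?src_inv // inv_l e comp_id_l. Qed.

Lemma gcompKV g f : src g = tgt f -> gcomp (gcomp g f) (ginv f) = g.
Proof. by move=> e; rewrite -Defs.compA ?tgt_inv // inv_r -e comp_id_r. Qed.

Lemma gcompVK g f : src g = src f -> gcomp (gcomp g (ginv f)) f = g.
Proof. by move=> e; rewrite -Defs.compA ?src_inv ?tgt_inv // inv_l -e comp_id_r. Qed.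

Lemma gcompI g f f' :
  src g = tgt f -> src g = tgt f' -> gcomp g f = gcomp g f' -> f = f'.
Proof. by move=> e e' eq; rewrite -(gcompK e) eq gcompK. Qed.

Lemma gcompIr f g g' :
  src g = tgt f -> src g' = tgt f -> gcomp g f = gcomp g' f -> g = g'.
Proof. by move=> e e' eq; rewrite -(gcompKV e) eq gcompKV. Qed.

(** The set whose non-emptiness is [gconj a b]; [intertw a a] is convertible to [centr a], which the
    cardinality lemmas below exploit. *)
Definition intertw a b : {set M} :=
  [set w | [&& src w == src a, tgt w == src b & gcomp w a == gcomp b w]].

Lemma intertwP a b w :
  reflect [/\ src w = src a, tgt w = src b & gcomp w a = gcomp b w]
          (w \in intertw a b).
Proof. by rewrite inE; apply: (iffP and3P) => [] [/eqP ? /eqP ? /eqP ?]; split=> //; apply/eqP. Qed.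

Lemma gconjP a b : reflect (exists w, w \in intertw a b) (gconj a b).
Proof. by apply: (iffP existsP) => [] [w H]; exists w; rewrite ?inE // in H *. Qed.

Lemma autCP a : reflect (src a = tgt a) (a \in autC C).
Proof. by rewrite inE; apply: eqP. Qed.

Lemma intertw_comp a b c v w : a \in autC C -> b \in autC C ->
  w \in intertw a b -> v \in intertw b c -> gcomp v w \in intertw a c.
Proof.
move=> /autCP aA /autCP bA /intertwP[sw tw ew] /intertwP[sv tv ev].
have svw : src v = tgt w by rewrite sv tw.
apply/intertwP; rewrite src_comp ?tgt_comp //; split=> //.
by rewrite -Defs.compA ?sw // ew Defs.compA ?sv // ev -Defs.compA.
Qed.

Lemma intertw_inv a b w : a \in autC C -> b \in autC C ->
  w \in intertw a b -> ginv w \in intertw b a.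
Proof.
move=> /autCP aA /autCP bA /intertwP[sw tw ew].
apply/intertwP; rewrite src_inv tgt_inv; split=> //.
apply: (@gcompIr w).
- by rewrite src_comp ?src_inv // tw -bA.
- by rewrite src_comp ?src_inv ?tgt_inv // sw.
by rewrite gcompVK // -Defs.compA ?src_inv ?tw // -ew gcompK // sw.
Qed.

Lemma intertw_id a : a \in autC C -> gid (src a) \in intertw a a.
Proof.
move=> /autCP aA; apply/intertwP; rewrite src_id tgt_id; split=> //.
by rewrite comp_id_r aA comp_id_l.
Qed.

Lemma gconj_refl a : a \in autC C -> gconj a a.
Proof. by move=> aA; apply/gconjP; exists (gid (src a)); apply: intertw_id. Qed.

Lemma gconj_sym a b : a \in autC C -> b \in autC C -> gconj a b -> gconj b a.
Proof.
by move=> aA bA /gconjP[w wP]; apply/gconjP; exists (ginv w); apply: intertw_inv.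
Qed.

Lemma gconj_trans b a c : a \in autC C -> b \in autC C ->
  gconj a b -> gconj b c -> gconj a c.
Proof.
move=> aA bA /gconjP[w wP] /gconjP[v vP]; apply/gconjP.
by exists (gcomp v w); apply: intertw_comp wP vP.
Qed.

Lemma eq_cls a b : a \in autC C -> b \in autC C -> (cls a == cls b) = gconj a b.
Proof.
move=> aA bA; apply/eqP/idP => [/setP/(_ b) | ab].
  by rewrite !inE -/(_ \in autC C) in bA *; rewrite bA gconj_refl // inE.
apply/setP=> c; rewrite !inE; case: eqP => //= /autCP cA.
apply/idP/idP; apply: gconj_trans => //; exact: gconj_sym.
Qed.

(** Left composition with a fixed intertwiner from [a] to [b] is injective. Symmetry of [gconj]
    later supplies the reverse inequality. *)
Lemma leq_card_intertwr a b c : c \in autC C -> a \in autC C -> gconj a b ->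
  #|intertw c a| <= #|intertw c b|.
Proof.
move=> cA aA /gconjP[w wP]; have /intertwP[sw _ _] := wP.
rewrite -(@card_in_imset _ _ (gcomp w)) => [|v v' /intertwP[_ tv _] /intertwP[_ tv' _]].
  by apply/subset_leq_card/subsetP=> _ /imsetP[v vP ->]; apply: intertw_comp vP wP.
by apply: gcompI; rewrite sw.
Qed.

Lemma leq_card_intertwl a b c : a \in autC C -> b \in autC C -> gconj a b ->
  #|intertw b c| <= #|intertw a c|.
Proof.
move=> aA bA /gconjP[w wP]; have /intertwP[_ tw _] := wP.
rewrite -(@card_in_imset _ _ (fun v => gcomp v w)) => [|v v' /intertwP[sv _ _] /intertwP[sv' _ _]].
  by apply/subset_leq_card/subsetP=> _ /imsetP[v vP ->]; apply: intertw_comp wP vP.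
by apply: gcompIr; rewrite tw.
Qed.

Lemma card_intertw a b : a \in autC C -> b \in autC C -> gconj a b ->
  #|intertw a b| = #|centr a|.
Proof.
move=> aA bA ab; have ba := gconj_sym aA bA ab.
by apply/eqP; rewrite eqn_leq !leq_card_intertwr.
Qed.

Lemma card_centr_gconj a b : a \in autC C -> b \in autC C -> gconj a b ->
  #|centr a| = #|centr b|.
Proof.
move=> aA bA ab; have ba := gconj_sym aA bA ab; rewrite -(card_intertw aA bA ab).
by apply/eqP; rewrite eqn_leq !leq_card_intertwl.
Qed.

(** Whichever representative [pick] returns is conjugate to [a], and the default 0 is excluded
    because [a] lies in its own class. *)
Lemma csize_cls a : a \in autC C -> csize (cls a) = #|centr a|.
Proof.
move=> aA; rewrite /csize; case: pickP => [b | /(_ a)].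
  by rewrite inE => /andP[bA ab]; apply/esym/card_centr_gconj.
by rewrite inE aA gconj_refl.
Qed.

Lemma csize_gt0 X : X \in digamma C -> 0 < csize X.
Proof.
case/imsetP=> a aA ->; rewrite csize_cls // card_gt0; apply/set0Pn.
by exists (gid (src a)); apply: intertw_id.
Qed.

(* With a chosen [w_L : K -> L] in [D] for each reachable [L], the map
   [f |-> f w_(tgt f)^-1] is injective into [autD D]. *)
Lemma card_wide_subgroupoid_out (D : {set M}) K : wide_subgroupoid D ->
  #|[set f in D | src f == K]| <= #|autD D|.
Proof.
case=> Did Dcomp Dinv.
(* The default is never reached when [L] is the target of some [f] in [D] out of [K], since [f]
   itself passes the test. *)
pose w L := odflt (gid K) [pick g in D | (src g == K) && (tgt g == L)].
have wP f : f \in D -> src f = K ->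
    [/\ w (tgt f) \in D, src (w (tgt f)) = K & tgt (w (tgt f)) = tgt f].
  move=> fD sf; rewrite /w; case: pickP => [g /and3P[gD /eqP ? /eqP ?] | /(_ f)] //=.
  by rewrite fD sf !eqxx.
pose F f := gcomp f (ginv (w (tgt f))).
have FP f : f \in D -> src f = K ->
    [/\ F f \in D, src (F f) = tgt f & tgt (F f) = tgt f].
  move=> fD sf; have [wD sw tw] := wP f fD sf.
  have e : src f = tgt (ginv (w (tgt f))) by rewrite tgt_inv sw.
  by rewrite /F src_comp // tgt_comp // src_inv tw; split=> //; apply: Dcomp; rewrite ?Dinv.
rewrite -(@card_in_imset _ _ F) => [|f f']; last first.
  rewrite !inE => /andP[fD /eqP sf] /andP[f'D /eqP sf'] e.
  have [_ _ t1] := FP f fD sf; have [_ _ t2] := FP f' f'D sf'.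
  have [_ sw _] := wP f fD sf.
  (* [F] keeps the target, so equal images involve the same chosen [w], which can be cancelled. *)
  have et : tgt f = tgt f' by rewrite -t1 -t2 e.
  move: e; rewrite /F -et => e.
  by apply: (gcompIr _ _ e); rewrite tgt_inv sw.
apply/subset_leq_card/subsetP=> _ /imsetP[f fP ->].
move: fP; rewrite !inE => /andP[fD /eqP sf].
by have [-> -> ->] := FP f fD sf; rewrite eqxx.
Qed.

(** * Wreath elements, products along orbits, and commutation *)

Lemma wr_src (x : wrT C) K : x \in wr C -> src (x.1 K) = K.
Proof. by rewrite inE => /forallP/(_ K)/andP[/eqP]. Qed.

Lemma wr_tgt (x : wrT C) K : x \in wr C -> tgt (x.1 K) = x.2 K.
Proof. by rewrite inE => /forallP/(_ K)/andP[_ /eqP]. Qed.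

(** The permutation can be read off from the targets of the components. *)
Lemma wr_inj : {in wr C &, injective (fun x : wrT C => x.1)}.
Proof.
move=> [x1 x2] [y1 y2] xw yw /= e; congr (_, _) => //.
by apply/permP=> K; rewrite -(wr_tgt K xw) -(wr_tgt K yw) /= e.
Qed.

Lemma wmul_eqP (a rh sg : wrT C) :
  reflect (forall K, gcomp (a.1 (rh.2 K)) (rh.1 K) = gcomp (sg.1 (a.2 K)) (a.1 K)
             /\ a.2 (rh.2 K) = sg.2 (a.2 K))
          (wmul a rh == wmul sg a).
Proof.
apply: (iffP eqP) => [[/ffunP e1 /permP e2] K | e].
  by have:= e1 K; have:= e2 K; rewrite !ffunE !permM.
congr (_, _); first by apply/ffunP=> K; rewrite !ffunE; have [] := e K.
by apply/permP=> K; rewrite !permM; have [] := e K.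
Qed.

Section LamIter.
Variable sg : wrT C.
Hypothesis sgw : sg \in wr C.

Lemma lam_iter_srctgt K m :
  src (lam_iter sg K m) = K /\ tgt (lam_iter sg K m) = iter m sg.2 K.
Proof.
elim: m => [|m [IHs IHt]] /=; first by rewrite src_id tgt_id.
by rewrite src_comp ?tgt_comp ?wr_src ?wr_tgt.
Qed.

Lemma src_lam K : src (lam sg K) = K.
Proof. by have [] := lam_iter_srctgt K #|porbit sg.2 K|. Qed.

Lemma lam_aut K : lam sg K \in autC C.
Proof.
apply/autCP; rewrite src_lam /lam.
by have [_ ->] := lam_iter_srctgt K #|porbit sg.2 K|; rewrite iter_porbit.
Qed.

End LamIter.

Section Commute.
Variables rh sg a : wrT C.
Hypotheses (rhw : rh \in wr C) (sgw : sg \in wr C) (aw : a \in wr C).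
Hypothesis comm_a : wmul a rh == wmul sg a.

Lemma comm_iter m K : a.2 (iter m rh.2 K) = iter m sg.2 (a.2 K).
Proof. by elim: m => //= m <-; have [] := wmul_eqP _ _ _ comm_a (iter m rh.2 K). Qed.

(** The one-step commutation squares are pasted along the orbit. *)
Lemma comm_lam_iter m K :
  gcomp (a.1 (iter m rh.2 K)) (lam_iter rh K m) =
  gcomp (lam_iter sg (a.2 K) m) (a.1 K).
Proof.
elim: m => [|m IH] /=.
  by rewrite -{2}(wr_src K aw) comp_id_r -(wr_tgt K aw) comp_id_l.
have [sr tr] := lam_iter_srctgt rhw K m.
have [ss ts] := lam_iter_srctgt sgw (a.2 K) m.
have [e1 e2] := wmul_eqP _ _ _ comm_a (iter m rh.2 K).
rewrite Defs.compA ?wr_src ?wr_tgt // e1 -Defs.compA ?wr_src ?wr_tgt //.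
by rewrite IH comm_iter Defs.compA ?wr_src ?wr_tgt.
Qed.

Lemma comm_porbit K : a.2 @: porbit rh.2 K = porbit sg.2 (a.2 K).
Proof.
apply/setP=> L; apply/imsetP/porbitP => [[_ /porbitP[m ->] ->] | [m ->]].
  by exists m; rewrite !permX comm_iter.
by exists ((rh.2 ^+ m)%g K); rewrite ?mem_porbit // !permX comm_iter.
Qed.

Lemma comm_card_porbit K : #|porbit sg.2 (a.2 K)| = #|porbit rh.2 K|.
Proof. by rewrite -comm_porbit card_imset //; apply: perm_inj. Qed.

(** This is [comm_lam_iter] after one full turn: both orbits have the same length, and the iterate
    of [K] is [K] again. *)
Lemma comm_intertw K : a.1 K \in intertw (lam rh K) (lam sg (a.2 K)).
Proof.
apply/intertwP; rewrite !src_lam // wr_src // wr_tgt //; split=> //.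
by rewrite /lam comm_card_porbit -comm_lam_iter iter_porbit.
Qed.

Lemma comm_cls K : cls (lam rh K) = cls (lam sg (a.2 K)).
Proof.
apply/eqP; rewrite eq_cls ?lam_aut //; apply/gconjP.
by exists (a.1 K); apply: comm_intertw.
Qed.

End Commute.

(** Since [sg] commutes with itself, [comm_cls] with [a = sg] shows that one step along the orbit
    keeps the label. *)
Lemma cls_lam_porbit (sg : wrT C) K L :
  sg \in wr C -> L \in porbit sg.2 K -> cls (lam sg L) = cls (lam sg K).
Proof.
move=> sgw /porbitP[m ->]; rewrite permX; elim: m => //= m <-.
by rewrite -(comm_cls sgw sgw sgw).
Qed.

(** * Orbits as a finite type, with representatives and types *)

Definition orb (s : {perm O}) := {X : {set O} | X \in porbits s}.

Definition orb_of (s : {perm O}) K : orb s := exist _ (porbit s K) (imset_f _ isT).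

Lemma orb_rep_subproof (s : {perm O}) (i : orb s) : exists K, orb_of s K == i.
Proof.
by case: i => X XP; have [K _ eX] := imsetP XP; exists K; rewrite -val_eqE /= eX.
Qed.

Definition orb_rep (s : {perm O}) (i : orb s) : O := xchoose (orb_rep_subproof i).

Lemma orb_repK (s : {perm O}) (i : orb s) : orb_of s (orb_rep i) = i.
Proof. exact/eqP/(xchooseP (orb_rep_subproof i)). Qed.

Lemma val_orb (s : {perm O}) (i : orb s) : val i = porbit s (orb_rep i).
Proof. by rewrite -{1}(orb_repK i). Qed.

Lemma eq_orb_of (s : {perm O}) K L : (orb_of s K == orb_of s L) = (K \in porbit s L).
Proof. by rewrite -val_eqE /= eq_porbit_mem. Qed.

Lemma orb_of_rep (s : {perm O}) K : K \in porbit s (orb_rep (orb_of s K)).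
Proof. by rewrite -eq_orb_of orb_repK. Qed.

(** The number of steps, less than the orbit length, leading from the chosen representative to
    [K]. *)
Definition orb_index (s : {perm O}) K : nat :=
  index K (traject s (orb_rep (orb_of s K)) #|porbit s K|).

Lemma orb_index_lt (s : {perm O}) K : orb_index s K < #|porbit s K|.
Proof.
have e : porbit s K = porbit s (orb_rep (orb_of s K)).
  by apply/eqP; rewrite eq_porbit_mem orb_of_rep.
have:= orb_of_rep s K; rewrite porbit_traject -index_mem size_traject.
by rewrite -e.
Qed.

Lemma orb_indexK (s : {perm O}) K :
  iter (orb_index s K) s (orb_rep (orb_of s K)) = K.
Proof.
rewrite -(nth_traject s (orb_index_lt s K)) nth_index // -index_mem size_traject.
exact: orb_index_lt.
Qed.

(** Bounding the length by [#|O|] makes the types a finite type; [inord] loses nothing, as no orbit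
    is larger. *)
Definition orb_type (sg : wrT C) (i : orb sg.2) : 'I_(#|O|.+1) * {set M} :=
  (inord #|val i|, cls (lam sg (orb_rep i))).

Lemma orb_card_lt (s : {perm O}) (i : orb s) : #|val i| < #|O|.+1.
Proof. by rewrite ltnS max_card. Qed.

Lemma orb_typeP (rh sg : wrT C) (i : orb rh.2) (j : orb sg.2) :
  orb_type i = orb_type j <->
  #|val i| = #|val j| /\ cls (lam rh (orb_rep i)) = cls (lam sg (orb_rep j)).
Proof.
split=> [[e ->] | [e c]]; last by rewrite /orb_type e c.
by split=> //; have:= congr1 val e; rewrite /= !inordK ?orb_card_lt.
Qed.

(** [cnt] tests the label at some point of the orbit and [orb_type] at the representative; labels
    are constant on orbits. *)
Lemma card_orb_type (sg : wrT C) (k : 'I_(#|O|.+1)) (X : {set M}) :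
  sg \in wr C -> #|[set i : orb sg.2 | orb_type i == (k, X)]| = cnt sg k X.
Proof.
move=> sgw; rewrite -(card_imset _ val_inj); apply: eq_card => Ob.
rewrite inE; apply/imsetP/and3P => [[i] | [ObP /eqP kP /exists_inP[K KOb /eqP cK]]].
  rewrite inE => /eqP[ki ci] ->; split; first exact: valP.
    by rewrite -ki inordK ?orb_card_lt.
  apply/exists_inP; exists (orb_rep i); last by rewrite ci.
  by rewrite val_orb porbit_id.
pose i : orb sg.2 := exist _ Ob ObP.
exists i => //; rewrite inE /orb_type -cK.
apply/eqP; congr (_, _); first by apply: val_inj; rewrite /= inordK ?kP.
by apply/esym/cls_lam_porbit => //; rewrite -val_orb.
Qed.

Lemma cnt0 (sg : wrT C) X : cnt sg 0 X = 0.
Proof.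
apply/eqP; rewrite cards_eq0; apply/eqP/setP=> Ob; rewrite !inE.
apply/negP=> /and3P[/imsetP[K _ ->]].
by rewrite (negbTE (card_porbit_neq0 _ _)).
Qed.

Lemma cnt_notin (sg : wrT C) k X : sg \in wr C -> X \notin digamma C -> cnt sg k X = 0.
Proof.
move=> sgw XN; apply/eqP; rewrite cards_eq0; apply/eqP/setP=> Ob; rewrite !inE.
apply/negP=> /and3P[_ _ /exists_inP[K _ /eqP eX]].
by case/negP: XN; rewrite -eX imset_f ?lam_aut.
Qed.

(** * Commuting elements and their values at orbit representatives *)

Section Count.
Variables rh sg : wrT C.
Hypotheses (rhw : rh \in wr C) (sgw : sg \in wr C).
Local Notation I := (orb rh.2).

Definition commuting : {set wrT C} := [set a in wr C | wmul a rh == wmul sg a].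

Definition root_values (a : wrT C) : {ffun I -> M} := [ffun i => a.1 (orb_rep i)].

Lemma root_values_inj : {in commuting &, injective root_values}.
Proof.
move=> a b /setIdP[aw ca] /setIdP[bw cb] /ffunP e; apply: wr_inj => //.
apply/ffunP=> K; have:= e (orb_of rh.2 K); rewrite !ffunE.
rewrite -[in a.1 K](orb_indexK rh.2 K) -[in b.1 K](orb_indexK rh.2 K).
set R := orb_rep _; set m := orb_index _ _ => eR.
(* Once [a] and [b] agree at [R], [comm_lam_iter] determines their common component [m] steps
   further, at [K]. *)
have e2 : a.2 R = b.2 R by rewrite -(wr_tgt R aw) -(wr_tgt R bw) eR.
have [_ tl] := lam_iter_srctgt rhw R m.
apply: (@gcompIr (lam_iter rh R m)); rewrite ?wr_src //.
by rewrite !(comm_lam_iter rhw sgw) // e2 eR.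
Qed.

(** The local conditions on a component at the representative; [tgt w] stands for the image of that
    representative under [a.2]. *)
Definition root_choice (i : I) : {set M} :=
  [set w | (w \in intertw (lam rh (orb_rep i)) (lam sg (tgt w)))
           && (#|val i| == #|val (orb_of sg.2 (tgt w))|)].

Lemma root_choice_type (i : I) w :
  w \in root_choice i -> orb_type (orb_of sg.2 (tgt w)) = orb_type i.
Proof.
rewrite inE => /andP[wi /eqP e]; apply/orb_typeP; split=> //.
apply: (@etrans _ _ (cls (lam sg (tgt w)))).
  by apply/esym/cls_lam_porbit => //; apply: orb_of_rep.
by apply/esym/eqP; rewrite eq_cls ?lam_aut //; apply/gconjP; exists w.
Qed.

Lemma card_root_choice (i : I) (j : orb sg.2) : orb_type j = orb_type i ->
  #|[set w in root_choice i | orb_of sg.2 (tgt w) == j]| =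
  (orb_type i).1 * csize (orb_type i).2.
Proof.
move=> /orb_typeP[eji cji]; rewrite /= csize_cls ?lam_aut // inordK ?orb_card_lt //.
set ai := lam rh _; rewrite -eji -sum1_card.
(* Sort by target: the orbit [j] offers [#|val j|] targets [L], each with as many intertwiners as
   the centralizer has elements. *)
rewrite (partition_big (@tgt C) (mem (val j))) /= => [|w].
  rewrite -sum_nat_const; apply: eq_bigr => L Lj.
  have Lj' : orb_of sg.2 L = j.
    by apply/eqP; rewrite -(orb_repK j) eq_orb_of -val_orb.
  rewrite sum1_card -(@card_intertw _ (lam sg L)) ?lam_aut //; last first.
    rewrite -eq_cls ?lam_aut // -cji; apply/eqP/esym/cls_lam_porbit => //.
    by rewrite -val_orb.
  apply: eq_card => w; rewrite unfold_in /=.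
  apply/andP/idP => [[] | wP].
    by rewrite !inE => /andP[/andP[H _] _] /eqP <-.
  have tw : tgt w = L by have /intertwP[_ -> _] := wP; rewrite src_lam.
  by rewrite inE [w \in root_choice i]inE tw Lj' -eji !eqxx wP.
by rewrite inE => /andP[_ /eqP <-]; rewrite /= porbit_id.
Qed.

Lemma root_values_choice (a : wrT C) i : a \in commuting -> root_values a i \in root_choice i.
Proof.
move=> /setIdP[aw ca]; rewrite ffunE inE wr_tgt // (comm_intertw rhw sgw) //=.
by rewrite (comm_card_porbit ca) val_orb.
Qed.

(** The injective map [a.2] carries orbits of [rh.2] onto orbits of [sg.2], so distinct orbits have
    distinct images. *)
Lemma root_values_orb_inj (a : wrT C) : a \in commuting ->
  injective (fun i => orb_of sg.2 (tgt (root_values a i))).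
Proof.
move=> /setIdP[aw ca] i j; rewrite !ffunE !wr_tgt // => /eqP.
rewrite eq_orb_of -(comm_porbit ca) => /imsetP[K Kj /perm_inj eK].
by rewrite -(orb_repK i) -(orb_repK j); apply/eqP; rewrite eq_orb_of eK.
Qed.

(* The component forced at [r^m K] by the component [w] at [K]. *)
Fixpoint transport (K : O) (w : M) (m : nat) : M :=
  if m is m'.+1 then
    gcomp (gcomp (sg.1 (iter m' sg.2 (tgt w))) (transport K w m'))
          (ginv (rh.1 (iter m' rh.2 K)))
  else w.

Lemma transport_srctgt K w m : src w = K ->
  src (transport K w m) = iter m rh.2 K /\
  tgt (transport K w m) = iter m sg.2 (tgt w).
Proof.
move=> sw; elim: m => //= m [IHs IHt].
have e : src (sg.1 (iter m sg.2 (tgt w))) = tgt (transport K w m) by rewrite wr_src.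
have e' : src (gcomp (sg.1 (iter m sg.2 (tgt w))) (transport K w m)) =
   tgt (ginv (rh.1 (iter m rh.2 K))) by rewrite src_comp // tgt_inv wr_src.
by rewrite src_comp // tgt_comp // src_inv tgt_comp // !wr_tgt.
Qed.

Lemma transportS K w m : src w = K ->
  gcomp (transport K w m.+1) (rh.1 (iter m rh.2 K)) =
  gcomp (sg.1 (iter m sg.2 (tgt w))) (transport K w m).
Proof.
move=> sw; have [IHs IHt] := transport_srctgt m sw.
by rewrite /= gcompVK // src_comp ?wr_src.
Qed.

Lemma transport_lam_iter K w m : src w = K ->
  gcomp (transport K w m) (lam_iter rh K m) = gcomp (lam_iter sg (tgt w) m) w.
Proof.
move=> sw; elim: m => [|m IH] /=; first by rewrite -sw comp_id_r comp_id_l.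
have [ss st] := transport_srctgt m sw.
have [ss' _] := transport_srctgt m.+1 sw.
have [sr tr] := lam_iter_srctgt rhw K m.
have [sl tl] := lam_iter_srctgt sgw (tgt w) m.
rewrite Defs.compA ?wr_src ?wr_tgt // transportS // -Defs.compA ?wr_src // ?ss //.
by rewrite IH Defs.compA ?wr_src.
Qed.

(** After a full turn, [transport_lam_iter] and the intertwining condition on [w] agree up to the
    factor [lam rh], which cancels. Hence transport is consistent around the cycle. *)
Lemma transport_period (i : I) w : w \in root_choice i ->
  transport (orb_rep i) w #|val i| = w.
Proof.
rewrite inE => /andP[/intertwP[sw _ ew] /eqP e].
rewrite src_lam // in sw.
have [ss _] := transport_srctgt #|val i| sw.
have lamE : lam_iter rh (orb_rep i) #|val i| = lam rh (orb_rep i).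
  by rewrite val_orb.
have tl : tgt (lam rh (orb_rep i)) = orb_rep i.
  by have /autCP<- := lam_aut rhw (orb_rep i); rewrite src_lam.
apply: (@gcompIr (lam rh (orb_rep i))); rewrite ?tl //.
  by rewrite ss val_orb iter_porbit.
by rewrite -{1}lamE transport_lam_iter // ew e.
Qed.

Lemma root_values_onto (f : {ffun I -> M}) :
  (forall i, f i \in root_choice i) ->
  injective (fun i => orb_of sg.2 (tgt (f i))) ->
  exists2 a, a \in commuting & root_values a = f.
Proof.
move=> fP fI.
have sf i : src (f i) = orb_rep i.
  by have:= fP i; rewrite inE => /andP[/intertwP[-> _ _] _]; rewrite src_lam.
pose a1 K := let i := orb_of rh.2 K in
  transport (orb_rep i) (f i) (orb_index rh.2 K).
have sa1 K : src (a1 K) = K.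
  rewrite /a1; have [-> _] := transport_srctgt (orb_index rh.2 K) (sf (orb_of rh.2 K)).
  by rewrite orb_indexK.
have ta1 K : tgt (a1 K) = iter (orb_index rh.2 K) sg.2 (tgt (f (orb_of rh.2 K))).
  by rewrite /a1; have [_ ->] := transport_srctgt (orb_index rh.2 K) (sf (orb_of rh.2 K)).
have oa1 K : orb_of sg.2 (tgt (a1 K)) = orb_of sg.2 (tgt (f (orb_of rh.2 K))).
  by apply/eqP; rewrite ta1 eq_orb_of -permX mem_porbit.
have cf (i : I) : #|val i| = #|porbit sg.2 (tgt (f i))|.
  by have:= fP i; rewrite inE => /andP[_ /eqP].
(* A common target forces a common orbit by [fI]. The matched [sg.2]-orbit has the same length, so
   its trajectory has no repetition and the positions agree too. *)
have a2I : injective (fun K => tgt (a1 K)).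
  move=> K L e; have eo : orb_of rh.2 K = orb_of rh.2 L by apply: fI; rewrite -!oa1 e.
  have cK : #|porbit rh.2 K| = #|porbit sg.2 (tgt (f (orb_of rh.2 K)))| by rewrite -cf.
  have cL : #|porbit rh.2 L| = #|porbit rh.2 K| by have /(congr1 val) /= -> := eo.
  have lK := orb_index_lt rh.2 K; have lL := orb_index_lt rh.2 L.
  rewrite cL cK in lL; rewrite cK in lK.
  rewrite -(orb_indexK rh.2 K) -(orb_indexK rh.2 L) -eo; congr (iter _ _ _).
  move/eqP: e; rewrite !ta1 -eo -(nth_traject sg.2 lK) -(nth_traject sg.2 lL).
  by rewrite nth_uniq ?size_traject ?uniq_traject_porbit // => /eqP.
(* The bound includes [m = #|val i|], where [transport_period] closes the cycle. *)
have a1E m (i : I) : m <= #|val i| -> a1 (iter m rh.2 (orb_rep i)) = transport (orb_rep i) (f i) m.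
  set K := iter _ _ _ => lem.
  have oK : orb_of rh.2 K = i.
    by apply/eqP; rewrite -[i in X in _ == X]orb_repK eq_orb_of /K -permX mem_porbit.
  have tK : #|porbit rh.2 K| = #|val i| by rewrite -oK.
  have ik : m < #|val i| -> orb_index rh.2 K = m.
    move=> ltm; rewrite /orb_index tK oK /K -(nth_traject rh.2 ltm) index_uniq ?size_traject //.
    by rewrite val_orb uniq_traject_porbit.
  have [ltm | ] := ltnP m #|val i|; first by rewrite /a1 ik // oK.
  move=> gem; have em : m = #|val i| by apply/eqP; rewrite eqn_leq lem.
  have KR : K = orb_rep i by rewrite /K em val_orb iter_porbit.
  rewrite em transport_period //.
  have i0 : orb_index rh.2 K = 0.
    rewrite /orb_index tK oK KR val_orb.
    by case: #|_| (card_porbit_neq0 rh.2 (orb_rep i)) => //= n _; rewrite eqxx.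
  by rewrite /a1 i0 oK.
pose a : wrT C := ([ffun K => a1 K], perm a2I).
have aw : a \in wr C.
  by rewrite inE; apply/forallP=> K; rewrite /= ffunE permE sa1 !eqxx.
exists a; last by apply/ffunP=> i; rewrite !ffunE /= (a1E 0).
rewrite inE aw; apply/wmul_eqP=> K; rewrite /= !ffunE !permE.
set i := orb_of rh.2 K.
have lK : orb_index rh.2 K < #|val i| := orb_index_lt rh.2 K.
have e1 : a1 (rh.2 K) = transport (orb_rep i) (f i) (orb_index rh.2 K).+1.
  by rewrite -a1E // /= orb_indexK.
have eK : K = iter (orb_index rh.2 K) rh.2 (orb_rep i) by rewrite orb_indexK.
split.
  by rewrite e1 {2}eK transportS // ta1.
by rewrite e1; have [_ ->] := transport_srctgt (orb_index rh.2 K).+1 (sf i); rewrite ta1.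
Qed.

Lemma card_commuting_root_values :
  #|commuting| = #|[set f : {ffun I -> M} | [forall i, f i \in root_choice i] &&
                     injectiveb [ffun i => orb_of sg.2 (tgt (f i))]]|.
Proof.
rewrite -(card_in_imset root_values_inj); apply: eq_card => f; rewrite inE.
apply/imsetP/andP => [[a aP ->] | [/forallP fP /injectiveP fI]].
  split; first by apply/forallP=> i; apply: root_values_choice.
  by apply/injectiveP=> i j; rewrite !ffunE -!(ffunE (fun i => a.1 (orb_rep i))); apply: root_values_orb_inj.
have [|a aP <-] := root_values_onto fP; last by exists a.
by move=> i j e; apply: fI; rewrite !ffunE.
Qed.

Lemma card_commuting :
  (forall k X, 0 < k -> X \in digamma C -> cnt rh k X = cnt sg k X) ->
  #|commuting| = \prod_(1 <= k < #|O|.+1) \prod_(X in digamma C)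
           ((cnt rh k X)`! * (k * csize X) ^ (cnt rh k X)).
Proof.
move=> eq_cnt; rewrite card_commuting_root_values.
rewrite (card_fibre_injection_lift (u := @orb_type sg) _ root_choice_type
  (n := fun x => x.1 * csize x.2)); last first.
- by move=> i j; apply: card_root_choice.
(* For types outside the range of [eq_cnt], both counts vanish. *)
- move=> [k X]; rewrite !card_orb_type //.
  have [k0 | k_gt0] := posnP k; first by rewrite k0 !cnt0.
  by have [XD | XN] := boolP (X \in digamma C); [apply: eq_cnt | rewrite !cnt_notin].
pose G k X := (cnt rh k X)`! * (k * csize X) ^ (cnt rh k X).
(* The product over all types exceeds the stated range only by [k = 0] and by sets that are not
   classes; there the count is 0 and [G] is 1. *)
transitivity (\prod_(k < #|O|.+1) \prod_X G k X).
  by rewrite pair_bigA /=; apply: eq_bigr => -[k X] _; rewrite card_orb_type.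
rewrite (big_ord_recl #|O|) big1 ?mul1n => [|X _]; last by rewrite /G cnt0.
rewrite big_add1 big_mkord; apply: eq_bigr => k _.
rewrite [RHS]big_mkcond; apply: eq_bigr => X _.
by case: ifPn => // XN; rewrite /G cnt_notin.
Qed.

(** [root_values] is injective and sends these elements to families of [D]-morphisms out of the
    representatives, one per orbit. *)
Lemma card_commuting_subgroupoid (D : {set M}) : wide_subgroupoid D ->
  ncommute (wrD D) rh sg <= #|autD D| ^ #|porbits rh.2|.
Proof.
move=> DP; have -> : #|porbits rh.2| = #|{: I}| by rewrite card_sig cardE.
rewrite -prod_nat_const.
pose W (i : I) := [set f in D | src f == orb_rep i].
apply: (@leq_trans (\prod_(i : I) #|W i|)); last first.
  by apply: leq_prod => i _; apply: card_wide_subgroupoid_out.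
have := card_family (fun i : I => mem (W i)).
rewrite foldrE big_map big_enum => <-.
rewrite /ncommute -(card_in_imset (f := root_values)) => [|a b]; last first.
  move=> /setIdP[/setIdP[aw _] ca] /setIdP[/setIdP[bw _] cb].
  by apply: root_values_inj; apply/setIdP.
apply/subset_leq_card/subsetP=> _ /imsetP[a /setIdP[/setIdP[aw /forallP aD] _] ->].
by apply/familyP=> i; rewrite ffunE inE aD wr_src ?eqxx.
Qed.

(** Taking images under [a.2] is a bijection between the orbits counted, as it preserves lengths and
    labels. *)
Lemma wr_conj_cnt k X : wr_conj rh sg -> cnt rh k X = cnt sg k X.
Proof.
case=> a aw /eqP ca; rewrite /cnt.
rewrite -(card_imset _ (imset_inj (@perm_inj _ a.2))); apply: eq_card => Ob.
apply/imsetP/idP => [[Oa] | ].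
  rewrite inE => /and3P[/imsetP[K _ ->] /eqP <- /exists_inP[L LK /eqP <-]] ->.
  rewrite inE (comm_porbit ca) imset_f //= (comm_card_porbit ca) eqxx.
  apply/exists_inP; exists (a.2 L); last by rewrite -(comm_cls rhw sgw aw ca).
  by rewrite -(comm_porbit ca) imset_f.
rewrite inE => /and3P[/imsetP[K _ ->] /eqP <- /exists_inP[L LK /eqP <-]].
exists (porbit rh.2 (a.2^-1 K)%g); last by rewrite (comm_porbit ca) permKV.
rewrite inE imset_f //= -(comm_card_porbit ca) permKV eqxx.
apply/exists_inP; exists (a.2^-1 L)%g; last by rewrite (comm_cls rhw sgw aw ca) permKV.
by rewrite -(mem_imset _ _ (@perm_inj _ a.2)) (comm_porbit ca) !permKV.
Qed.

End Count.
End Groupoid.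

Theorem mainTheorem12 (C : groupoid) (rh sg : wrT C) :
  rh \in wr C -> sg \in wr C ->
  [/\ wr_conj rh sg <->
        (forall k X, 0 < k -> X \in digamma C -> cnt rh k X = cnt sg k X),
      (forall k X, 0 < k -> X \in digamma C -> cnt rh k X = cnt sg k X) ->
        ncommute (wr C) rh sg =
        \prod_(1 <= k < #|gobj C|.+1) \prod_(X in digamma C)
           ((cnt rh k X)`! * (k * csize X) ^ (cnt rh k X)) &
      forall D : {set gmor C}, wide_subgroupoid D ->
        ncommute (wrD D) rh sg <= #|autD D| ^ #|porbits rh.2| ].
Proof.
move=> rhw sgw; split; last exact: card_commuting_subgroupoid.
- split=> [conj k X _ _ | eq_cnt]; first exact: wr_conj_cnt.
  (* A conjugating element comes from the count itself: every factor of the product is positive. *)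
  have : 0 < #|commuting rh sg|.
    rewrite card_commuting // big_nat_cond; apply: prodn_cond_gt0 => k.
    rewrite andbT => /andP[k_gt0 _]; apply: prodn_cond_gt0 => X XD.
    by rewrite muln_gt0 fact_gt0 expn_gt0 muln_gt0 k_gt0 csize_gt0.
  by case/card_gt0P=> a /setIdP[aw /eqP ca]; exists a.
exact: card_commuting.
Qed.
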